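(* Let $X$ be a real-valued random variable with distribution function $F(x)=\mathbb{P}(X\le x)$, $-\infty<x<\infty$, and let $\{X_n;\ n\ge 1\}$ be a sequence of i.i.d. random variables with common distribution function $F$. Let $$\rho_2=\sup\left\{r\ge 0:\ \liminf_{x\to\infty}x^r\,\mathbb{P}(X>x)=0\right\}\in[0,\infty].$$ Then $$\liminf_{n\to\infty}\frac{\log\max_{1\le k\le n}X_k}{\log n}=\frac{1}{\rho_2}\quad\text{almost surely},$$ and there exists an increasing sequence of positive integers $\{m_n;\ n\ge1\}$ (non-random, and depending on the probability distribution of $X$ when $\rho_2>0$) such that $$\lim_{n\to\infty}\frac{\log\max_{1\le k\le m_n}X_k}{\log m_n}=\frac{1}{\rho_2}\quad\text{almost surely}.$$
   Context: Convention: $\log x=\ln(e\vee x)=\ln\max(e,x)$ for all $-\infty<x<\infty$, where $\ln$ is the natural logarithm (so $\log x\ge 1$ always). Also $1/0=\infty$ and $1/\infty=0$; limits, limsups and liminfs are taken in $[0,\infty]$. An increasing sequence of integers means $m_1<m_2<\cdots$. *)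

(* Defs.v *)
From HB Require Import structures.
From mathcomp Require Import all_boot all_order all_algebra finmap.
From mathcomp Require Import all_classical all_reals all_analysis.

Set Implicit Arguments.
Unset Strict Implicit.
Unset Printing Implicit Defensive.

Import Order.TTheory GRing.Theory Num.Theory.
Import numFieldNormedType.Exports.

Local Open Scope classical_set_scope.
Local Open Scope ring_scope.

Definition logp {R : realType} (x : R) : R := ln (Num.max (expR 1) x).

Definition mutually_independent d (T : measurableType d) (R : realType)
    (P : probability T R) (Xs : nat -> {RV P >-> R}) : Prop :=
  forall (J : {fset nat}) (B : nat -> set R),
    (forall i, i \in J -> measurable (B i)) ->
    P (\bigcap_(i in [set` J]) (Xs i @^-1` B i)) =
    (\prod_(i <- J) P (Xs i @^-1` B i))%E.

Definition iid_with_cdf d (T : measurableType d) (R : realType)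
    (P : probability T R) (F : R -> \bar R) (Xs : nat -> {RV P >-> R}) : Prop :=
  mutually_independent Xs /\ (forall k x, cdf (Xs k) x = F x).

(* [ccdf X x] is P(X > x). *)
Definition rho2 d (T : measurableType d) (R : realType)
    (P : probability T R) (X : {RV P >-> R}) : \bar R :=
  ereal_sup [set r%:E | r in [set r : R | 0 <= r /\
    limf_einf (fun x : R => ((x `^ r)%:E * ccdf X x)%E) (pinfty_nbhs R) = 0%E]].

(* The sequence is indexed from 0: [Xs k] stands for X_{k+1}, so that
   [partial_max Xs n] is max_{1 <= k <= n} X_k for n >= 1. The value at n = 0
   is the junk value [Xs 0]. *)
Definition partial_max d (T : measurableType d) (R : realType)
    (P : probability T R) (Xs : nat -> {RV P >-> R}) (n : nat) (w : T) : R :=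
  \big[Num.max/Xs 0%N w]_(k < n) Xs k w.

Definition log_max_ratio d (T : measurableType d) (R : realType)
    (P : probability T R) (Xs : nat -> {RV P >-> R}) (n : nat) (w : T) : \bar R :=
  (logp (partial_max Xs n w) / logp n%:R)%:E.

(* Main.v *)
(* If b < 1/rho2, the tail satisfies G(x) = P(X > x) >= c x^-r near +oo for
   some r < 1/b, whence P(M_n <= n^b) = (1 - G(n^b))^n <= exp(-c n^(1 - b r))
   is summable, and by Borel-Cantelli log M_n / log n >= b eventually. If
   r < rho2, then 2 x^r G(x) is small for arbitrarily large x; with
   m = floor(x^r) + 1 we get P(M_m > x) <= m G(x) while log x <= log m / r.
   Picking such pairs (x_n, m_n) with m_n G(x_n) <= n^-2 and 1/r -> 1/rho2, and
   applying Borel-Cantelli again, bounds the ratio from above along m_n. *)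
Require Import Defs.
From HB Require Import structures.
From mathcomp Require Import all_boot all_order all_algebra finmap.
From mathcomp Require Import all_classical all_reals all_analysis.
From mathcomp Require Import ring lra.

Import Order.TTheory GRing.Theory Num.Theory.
Import numFieldNormedType.Exports.

Local Open Scope classical_set_scope.
Local Open Scope ring_scope.

(** * A summable bound and the Borel-Cantelli lemma *)

(** The induction runs on the sharper bound [2 - 1/(n+1)] for [n+1] terms, because [1/a - 1/(a+1)]
    exceeds [1/(a+1)^2]. *)
Lemma inv_sqr_sum_le (R : realType) (n : nat) :
  \sum_(0 <= i < n) (i.+1%:R ^+ 2)^-1 <= 2 :> R.
Proof.
suff: \sum_(0 <= i < n.+1) (i.+1%:R ^+ 2)^-1 <= 2 - n.+1%:R^-1 :> R.
  rewrite big_nat_recr//=; have : 0 <= (n.+1%:R ^+ 2)^-1 :> R by [].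
  have : 0 <= n.+1%:R^-1 :> R by [].
  move: (\sum_(0 <= i < n) _) (n.+1%:R ^- 2) (n.+1%:R^-1) => a b c ? ? ?.
  by lra.
elim: n => [|n IHn]; first by rewrite big_nat1 expr1n invr1; lra.
rewrite big_nat_recr//=; apply: (le_trans (lerD IHn (lexx _))).
have a0 : 0 < n.+1%:R :> R by [].
rewrite -[n.+2]addn1 natrD; set a : R := n.+1%:R in a0 *.
rewrite -subr_ge0.
have -> : 2 - (a + 1)^-1 - (2 - a^-1 + ((a + 1) ^+ 2)^-1) =
  (a * (a + 1) ^+ 2)^-1 by field; rewrite !gt_eqF//; lra.
by rewrite invr_ge0 mulr_ge0 ?sqr_ge0// ltW.
Qed.

Lemma borel_cantelli_inv_sqr {d} {T : measurableType d} {R : realType}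
    (P : probability T R) (A : nat -> set T) (C : R) :
  (forall n, measurable (A n)) ->
  (\forall n \near \oo, (P (A n) <= (C / n.+1%:R ^+ 2)%:E)%E) ->
  {ae P, forall w, \forall n \near \oo, ~ A n w}.
Proof.
move=> mA [N _ leA].
(* The hypothesis bounds [P (A n)] only from [N] on, so the earlier events are emptied. An empty
   event needs a nonnegative bound, hence [|C|] below. *)
pose B n := if (N <= n)%N then A n else set0.
have mB n : measurable (B n) by rewrite /B; case: ifP.
have PB n : (P (B n) <= (`|C| / n.+1%:R ^+ 2)%:E)%E.
  rewrite /B; case: ifPn => [Nn|_]; last by rewrite measure0 lee_fin divr_ge0.
  apply: (le_trans (leA _ Nn)); rewrite lee_fin ler_wpM2r//; exact: ler_norm.
have PB0 : P (lim_sup_set B) = 0%E.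
  apply: lim_sup_set_cvg0 => //; apply: (@le_lt_trans _ _ (`|C| * 2)%:E).
    apply: lime_le; first by apply: is_cvg_nneseries.
    apply: nearW => n.
    apply: (@le_trans _ _ (\sum_(0 <= i < n) (`|C| / i.+1%:R ^+ 2)%:E)%E).
      by apply: lee_sum => i _; exact: PB.
    by rewrite sumEFin lee_fin -mulr_sumr ler_wpM2l// inv_sqr_sum_le.
  exact: ltry.
exists (lim_sup_set B); split => //.
  by apply: bigcap_measurable => // k _; exact: bigcup_measurable.
move=> w /= nA k _; apply: contrapT => nB; apply: nA.
exists (maxn N k) => // n /=; rewrite geq_max => /andP[Nn kn] An.
by apply: nB; exists n => //; rewrite /B Nn.
Qed.

(** * Lower limits at infinity *)

(** Otherwise [f >= e] on the whole ray beyond [N], and the infimum over that one neighbourhood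
    already forces the liminf to be at least [e]. *)
Lemma limf_einf_eq0_lt {R : realType} (f : R -> \bar R) (e : \bar R) (N : R) :
  limf_einf f (pinfty_nbhs R) = 0%E -> (0 < e)%E ->
  exists2 x, N < x & (f x < e)%E.
Proof.
rewrite limf_einfE => f0 e0; apply: contrapT => nf.
suff : (e <= 0)%E by rewrite leNgt e0.
rewrite -f0; apply: (@le_trans _ _ (ereal_inf (f @` [set x | N < x]))).
  apply: le_ereal_inf_tmp => _ [x /= Nx <-]; rewrite leNgt; apply/negP => fxe.
  by apply: nf; exists x.
apply: ereal_sup_ubound; exists [set x | N < x] => //.
by exists N; split => //; exact: num_real.
Qed.

Lemma limf_einf_neq0_ge {R : realType} (f : R -> \bar R) :
  (forall x, 0 <= f x)%E -> limf_einf f (pinfty_nbhs R) <> 0%E ->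
  exists2 c : R, 0 < c & \forall x \near +oo, (c%:E <= f x)%E.
Proof.
rewrite limf_einfE => f0 /eqP fn0.
have : (0 < ereal_sup [set ereal_inf (f @` V) | V in pinfty_nbhs R])%E.
  rewrite lt_neqAle eq_sym fn0/=.
  apply: (@le_trans _ _ (ereal_inf (f @` setT))).
    by apply: le_ereal_inf_tmp => _ [x _ <-].
  by apply: ereal_sup_ubound; exists setT => //; exact: filterT.
move=> /ereal_sup_gt[_ [V FV <-]] infV.
have fV x : V x -> (ereal_inf (f @` V) <= f x)%E.
  by move=> Vx; apply: ereal_inf_lbound; exists x.
case: (ereal_inf _) infV fV => [c c0 fV|_ fV|//].
  by exists c; [rewrite -lte_fin|apply: filterS FV].
(* An infinite infimum makes [f] equal to [+oo] on [V], so any positive constant serves. *)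
exists 1 => //; apply: filterS FV => x /fV; rewrite leye_eq => /eqP ->.
exact: leey.
Qed.

(** * Distribution of the partial maxima *)

Lemma cdf_fine {d} {T : measurableType d} {R : realType} (P : probability T R)
  (X : {RV P >-> R}) x : cdf X x = (1 - fine (ccdf X x))%:E.
Proof. by rewrite cdf_1_ccdf EFinB fineK// fin_num_measure. Qed.

(** Once [n > 0], the initial value [Xs 0 w] of the iterated maximum is one of the first [n] values
    and adds no constraint. *)
Lemma partial_max_le {d} {T : measurableType d} {R : realType}
    (P : probability T R) (Xs : nat -> {RV P >-> R}) (n : nat) x w :
  (0 < n)%N ->
  (partial_max Xs n w <= x) <-> (forall k, (k < n)%N -> Xs k w <= x).
Proof.
move=> n0; rewrite /partial_max; split => [/bigmax_leP[_ le] k kn|le].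
  exact: (le (Ordinal kn)).
by apply/bigmax_leP; split; [exact: le|move=> i _; exact: le].
Qed.

Lemma partial_max_le_set {d} {T : measurableType d} {R : realType}
    (P : probability T R) (Xs : nat -> {RV P >-> R}) (n : nat) x :
  (0 < n)%N ->
  [set w | partial_max Xs n w <= x] =
  \bigcap_(k in [set` [fset k in iota 0 n]%fset]) (Xs k @^-1` `]-oo, x]).
Proof.
move=> n0; apply/seteqP; split => w /=.
  move=> /partial_max_le - /(_ n0) le k /=.
  by rewrite !inE mem_iota add0n => kn; exact: le.
move=> le; apply/partial_max_le => // k kn; have /= := le k.
by rewrite !inE mem_iota add0n; apply.
Qed.

Lemma measurable_partial_max_le {d} {T : measurableType d} {R : realType}
    (P : probability T R) (Xs : nat -> {RV P >-> R}) (n : nat) x :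
  (0 < n)%N -> measurable [set w | partial_max Xs n w <= x].
Proof.
move=> n0; rewrite partial_max_le_set//; apply: bigcap_measurableType => k _.
by rewrite -[X in measurable X]setTI; exact: measurable_funPT.
Qed.

(** Independence gives a product of [n] equal factors. [X] may live on another probability space
    than [Xs]; only the cdf links them. *)
Lemma prob_partial_max_le {R : realType}
    {d0} {T0 : measurableType d0} {P0 : probability T0 R} (X : {RV P0 >-> R})
    {d} {T : measurableType d} {P : probability T R} (Xs : nat -> {RV P >-> R})
    (n : nat) x :
  iid_with_cdf (cdf X) Xs -> (0 < n)%N ->
  P [set w | partial_max Xs n w <= x] = ((1 - fine (ccdf X x)) ^+ n)%:E.
Proof.
move=> [indep eqcdf] n0; rewrite partial_max_le_set// indep//.
under eq_bigr => k _ do rewrite [P _](eqcdf k x) cdf_fine.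
rewrite prodEFin big_const_seq count_predT iter_mulr_1.
by rewrite card_fseq undup_id ?iota_uniq// size_iota.
Qed.

(** * Logarithms, powers and exponentials *)

Lemma logp_ge1 {R : realType} (x : R) : 1 <= logp x.
Proof.
by rewrite -[leLHS](expRK 1) ler_ln ?posrE ?lt_max ?expR_gt0// le_max lexx.
Qed.

Lemma logp_id {R : realType} (x : R) : expR 1 <= x -> logp x = ln x.
Proof. by move=> ex; rewrite /logp max_r. Qed.

Lemma ler_logp {R : realType} : {homo @logp R : x y / x <= y}.
Proof.
move=> x y xy; rewrite ler_ln ?posrE ?lt_max ?expR_gt0//.
by rewrite ge_max !le_max lexx xy orbT.
Qed.

Lemma ln_le_logp {R : realType} (x : R) : ln x <= logp x.
Proof.
have [x0|x0] := ltP 0 x; last by rewrite ln0// (le_trans _ (logp_ge1 x)).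
by rewrite ler_ln ?posrE ?lt_max ?expR_gt0// le_max lexx orbT.
Qed.

Lemma powR_cvgy {R : realType} (b : R) : 0 < b -> x `^ b @[x --> +oo] --> +oo.
Proof.
move=> b0; apply/cvgryPge => A; near=> x.
have x0 : 0 <= x by near: x; exact: nbhs_pinfty_ge.
apply: (@le_trans _ _ ((`|A| `^ b^-1) `^ b)).
  by rewrite -powRrM mulVf ?gt_eqF// powRr1// ler_norm.
apply: ge0_ler_powR; rewrite ?nnegrE ?powR_ge0// ?ltW//.
Unshelve. all: by end_near. Qed.

(** A single term of the exponential series suffices: [exp y >= y^(k+1)/(k+1)!] at [y = c x^s], with
    [k] so large that [s(k+1) >= 2]. *)
Lemma expRN_le_powR {R : realType} (c s : R) : 0 < c -> 0 < s ->
  exists C : R, forall x, 1 <= x -> expR (- (c * x `^ s)) <= C / x ^+ 2.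
Proof.
move=> c0 s0; pose k := Num.truncn (2 / s).
have ks : 2 <= s * k.+1%:R.
  by rewrite mulrC -ler_pdivrMr// ltW// truncnS_gt.
exists ((k.+1)`!%:R / c ^+ k.+1) => x x1; have x0 := lt_le_trans ltr01 x1.
set y := c * x `^ s; have y0 : 0 < y by rewrite mulr_gt0// powR_gt0.
have yk : c ^+ k.+1 * x ^+ 2 <= y ^+ k.+1.
  rewrite /y exprMn ler_wpM2l ?exprn_ge0 ?(ltW c0)//.
  rewrite -[x ^+ 2]powR_mulrn ?(ltW x0)// -[leRHS]powR_mulrn ?powR_ge0//.
  by rewrite -powRrM; apply: ler_powR.
rewrite expRN -mulrA -invfM.
have /(le_trans _)-> // : ((y ^+ k.+1) / (k.+1)`!%:R)^-1 <=
    (k.+1)`!%:R * (c ^+ k.+1 * x ^+ 2)^-1.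
  rewrite invfM invrK mulrC ler_wpM2l// lef_pV2// posrE ?mulr_gt0 ?exprn_gt0//.
rewrite lef_pV2 ?posrE ?expR_gt0 ?divr_gt0 ?exprn_gt0 ?ltr0n ?fact_gt0//.
by apply: le_trans (expR_ge1Dxn k (ltW y0)); rewrite lerDr.
Qed.

(** * Tail exponents and the tail index *)

(** Restated for a bare function so that the norming sequence can be built from a law on [R];
    [tail_index (ccdf X)] is [rho2 X] by conversion. *)
Definition tail_exponents {R : realType} (g : R -> \bar R) : set R :=
  [set r : R | 0 <= r /\
    limf_einf (fun x : R => ((x `^ r)%:E * g x)%E) (pinfty_nbhs R) = 0%E].

Definition tail_index {R : realType} (g : R -> \bar R) : \bar R :=
  ereal_sup [set r%:E | r in tail_exponents g].

Section ccdf_tail.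
Context {R : realType} {d0} {T0 : measurableType d0} {P0 : probability T0 R}.
Context (X : {RV P0 >-> R}).
Let G x := fine (ccdf X x).

Lemma ccdf_fine x : ccdf X x = (G x)%:E.
Proof. by rewrite fineK// fin_num_measure. Qed.

Lemma fine_ccdf_ge0 x : 0 <= G x.
Proof. by rewrite fine_ge0// measure_ge0. Qed.

Lemma fine_ccdf_le1 x : G x <= 1.
Proof. by rewrite -lee_fin -ccdf_fine probability_le1. Qed.

Lemma powR_ccdf_ge0 r x : (0 <= (x `^ r)%:E * ccdf X x)%E.
Proof. by rewrite mule_ge0 ?lee_fin ?powR_ge0// measure_ge0. Qed.

(** The exponent 0 is admissible because [P(X > x)] tends to 0. *)
Lemma rho2_ge0 : (0 <= rho2 X)%E.
Proof.
apply: ereal_sup_ubound; exists 0 => //; split => //.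
apply: contrapT => /limf_einf_neq0_ge - /(_ (powR_ccdf_ge0 0))[c c0 Fc].
have /fine_cvgP[_ /cvgr_lt] := @cvg_ccdfy0 _ _ _ P0 X.
move=> /(_ _ c0) Gc.
have [x [/= cx]] := @filter_ex _ _ (@proper_pinfty_nbhs R) _ (filterI Fc Gc).
by rewrite ltNge -lee_fin -ccdf_fine -[leRHS]mul1e -(powRr0 x) cx.
Qed.

Lemma rho2_lt_powR_ccdf (r : R) : 0 <= r -> (rho2 X < r%:E)%E ->
  exists2 c : R, 0 < c & \forall x \near +oo, c <= x `^ r * G x.
Proof.
move=> r0 rhor.
have [|c c0 Fc] := limf_einf_neq0_ge _ (powR_ccdf_ge0 r).
  move=> lim0; move: rhor; apply/negP; rewrite -leNgt.
  by apply: ereal_sup_ubound; exists r.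
by exists c => //; apply: filterS Fc => x; rewrite ccdf_fine -EFinM lee_fin.
Qed.

Lemma tail_exponents_ccdf_le (r e : R) (N : nat) :
  tail_exponents (ccdf X) r -> 0 < r -> 0 < e ->
  exists m x, [/\ (N < m)%N, expR 1 <= x, m%:R * G x <= e &
    ln x <= r^-1 * ln m%:R].
Proof.
move=> [_ lim0] r0 e0.
have e20 : (0 < (e / 2)%:E)%E by rewrite lte_fin divr_gt0.
(* Taking [x > e] gives [x^r >= 1], hence [m <= 2 x^r], which the threshold [e / 2] absorbs. Taking
   [x > N^(1/r)] gives [m > x^r > N]. *)
have [x] := limf_einf_eq0_lt _ _ (Num.max (expR 1) (N%:R `^ r^-1)) lim0 e20.
rewrite gt_max => /andP[ex Nx]; rewrite ccdf_fine -EFinM lte_fin => Ge.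
have x1 : 1 <= x by have := expR_ge1Dx (1 : R); lra.
have x0 : 0 < x := lt_le_trans ltr01 x1.
have xr1 : 1 <= x `^ r.
  by rewrite -(powRr0 x); apply: ler_powR => //; exact: ltW.
have xm := truncnS_gt (x `^ r).
exists (Num.truncn (x `^ r)).+1, x; split.
- rewrite -(ltr_nat R); apply: le_lt_trans xm.
  have -> : N%:R = (N%:R `^ r^-1) `^ r.
    by rewrite -powRrM mulVf ?lt0r_neq0// powRr1.
  by apply: ge0_ler_powR; rewrite ?nnegrE ?powR_ge0//; exact: ltW.
- exact: ltW.
- apply: (@le_trans _ _ ((2 * x `^ r) * G x)); last by lra.
  rewrite ler_wpM2r ?fine_ccdf_ge0// -natr1.
  have : (Num.truncn (x `^ r))%:R <= x `^ r by rewrite truncn_le powR_ge0.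
  by lra.
- rewrite mulrC ler_pdivlMr// mulrC -ln_powR ler_ln ?posrE ?powR_gt0//.
  exact: ltW.
Qed.

End ccdf_tail.

(** * Bounds on [(1 - p)^n] and order on the extended reals *)

Lemma onem_exprn_le_expR {R : realType} (p : R) (n : nat) :
  0 <= p <= 1 -> (1 - p) ^+ n <= expR (- (n%:R * p)).
Proof.
move=> /andP[p0 p1]; rewrite -mulrN expRM_natl.
rewrite lerXn2r ?nnegrE ?subr_ge0 ?expR_ge0//.
exact: expR_ge1Dx.
Qed.

Lemma bernoulli_ge {R : realDomainType} (p : R) (n : nat) :
  0 <= p <= 1 -> 1 - n%:R * p <= (1 - p) ^+ n.
Proof.
move=> /andP[p0 p1]; elim: n => [|n IHn]; first by rewrite mul0r subr0 expr0.
rewrite exprS; apply: (@le_trans _ _ ((1 - p) * (1 - n%:R * p))).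
  have : 0 <= n%:R * p ^+ 2 by rewrite mulr_ge0// sqr_ge0.
  by rewrite -natr1; nra.
by rewrite ler_wpM2l ?subr_ge0.
Qed.

Lemma inve_gt_EFin {R : realType} (x : \bar R) (b : R) : (0 <= x)%E -> 0 < b ->
  (b%:E < x^-1)%E -> (x < (b^-1)%:E)%E.
Proof.
move=> + b0; case: x => [t| |]//; last by rewrite invey lte_fin ltNge (ltW b0).
rewrite lee_fin inver => t0; case: eqP => [->|/eqP tn0].
  by rewrite lte_fin invr_gt0.
have {tn0} {}t0 : 0 < t by rewrite lt_neqAle eq_sym tn0.
by rewrite !lte_fin -[X in _ -> X < _]invrK ltf_pV2 ?posrE ?invr_gt0.
Qed.

(** Allows finite and infinite values of [1/rho2] to be treated alike, through the reals below
    them. *)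
Lemma lee_EFin_dense {R : realType} (x y : \bar R) :
  (forall b : R, (b%:E < x)%E -> (b%:E <= y)%E) -> (x <= y)%E.
Proof.
case: x => [r| |]; case: y => [s| |]//=; rewrite ?leey ?leNye//.
- move=> le; rewrite leNgt lte_fin; apply/negP => sr.
  have : (s + r) / 2 <= s by rewrite -lee_fin le// lte_fin; lra.
  by lra.
- by move=> /(_ (r - 1)) => /(_ ltac:(rewrite lte_fin; lra)).
- by move=> /(_ (s + 1)); rewrite lee_fin ltry gerDl ler10 => /(_ isT).
- by move=> /(_ 0 (ltry _)).
Qed.

(** * Probability bounds for the maxima and the almost sure lower estimate *)

Section iid_maxima.
Context {R : realType} {d0} {T0 : measurableType d0} {P0 : probability T0 R}.
Context (X : {RV P0 >-> R}).
Context {d} {T : measurableType d} {P : probability T R}.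
Context (Xs : nat -> {RV P >-> R}) (iidX : iid_with_cdf (cdf X) Xs).
Let G x := fine (ccdf X x).

Lemma prob_partial_max_powR_le (b : R) : 0 < b -> (rho2 X < (b^-1)%:E)%E ->
  exists C : R, \forall n \near \oo,
    (P [set w | (partial_max Xs n.+1 w <= n.+1%:R `^ b)%R]
      <= (C / n.+1%:R ^+ 2)%:E)%E.
Proof.
move=> b0 rhob.
(* The midpoint of [rho2] and [1/b]: above [rho2] for the tail bound, below [1/b] so that the
   exponent [1 - b r] is positive. *)
have [r [r0 rhor rb]] : exists r : R, [/\ 0 <= r, (rho2 X < r%:E)%E & r < b^-1].
  case: (rho2 X) rhob (rho2_ge0 X) => [t| |]//.
  rewrite lte_fin lee_fin => tb t0.
  by exists ((t + b^-1) / 2); rewrite lte_fin; split; lra.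
have [c c0 Fc] := rho2_lt_powR_ccdf X r r0 rhor.
have s0 : 0 < 1 - b * r by rewrite subr_gt0 mulrC -ltr_pdivlMr// mul1r.
have [C leC] := expRN_le_powR c _ c0 s0.
have nb : (n.+1%:R : R) `^ b @[n --> \oo] --> +oo.
  apply: (cvg_comp (fun n => n.+1%:R : R) (fun x => x `^ b)); last first.
    exact: powR_cvgy.
  by have := @cvgr_idn R; rewrite -cvg_shiftS.
have Fn : \forall n \near \oo,
    c <= (n.+1%:R `^ b) `^ r * G (n.+1%:R `^ b) := nb _ Fc.
exists C; apply: filterS Fn => n cn.
rewrite (prob_partial_max_le X) // lee_fin.
have n1 : 1 <= n.+1%:R :> R by rewrite ler1n.
apply: le_trans (leC _ n1).
apply: (le_trans (onem_exprn_le_expR _ _ _)).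
  by rewrite fine_ccdf_ge0 fine_ccdf_le1.
(* Multiplying by [n^(b r)], with [n] for [n.+1], reduces [c n^(1 - b r) <= n G(n^b)] to the tail
   bound [cn]. *)
rewrite ler_expR lerN2 -(ler_pM2r (_ : 0 < n.+1%:R `^ (b * r))); last first.
  by rewrite powR_gt0.
rewrite -mulrA -powRD ?subrK; last by rewrite pnatr_eq0 implybT.
by rewrite powRr1// mulrC -mulrA ler_wpM2l// mulrC powRrM.
Qed.

Lemma log_max_ratio_ge (b : R) : 0 < b -> (b%:E < (rho2 X)^-1)%E ->
  {ae P, forall w, \forall n \near \oo, (b%:E <= log_max_ratio Xs n w)%E}.
Proof.
move=> b0 brho.
have rhob := inve_gt_EFin _ _ (rho2_ge0 X) b0 brho.
have [C leC] := prob_partial_max_powR_le b b0 rhob.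
have := borel_cantelli_inv_sqr P _ C _ leC.
move=> /(_ (fun n => measurable_partial_max_le P Xs n.+1 _ (ltn0Sn n))).
apply: filterS => w Mw; apply: near_inftyS; near=> n.
have : ~ (partial_max Xs n.+1 w <= n.+1%:R `^ b) by near: n.
move/negP; rewrite -ltNge => ltM; rewrite lee_fin ler_pdivlMr; last first.
  exact: lt_le_trans (logp_ge1 _).
rewrite logp_id; last first.
  have en : expR 1 <= n%:R :> R by near: n; exact: nbhs_infty_ger.
  by rewrite (le_trans en)// ler_nat.
apply: le_trans (ln_le_logp _); rewrite -ln_powR.
by rewrite ler_ln ?posrE ?powR_gt0// ?ltW// (lt_trans _ ltM)// powR_gt0.
Unshelve. all: by end_near. Qed.

(** The exceptional null set for a fixed [b] depends on [b]. Positive rationals, enumerated by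
    [unpickle], give one null set for all [b]; for [b <= 0] the claim is trivial since the ratio is
    nonnegative. *)
Lemma ae_log_max_ratio_ge :
  {ae P, forall w (b : R), (b%:E < (rho2 X)^-1)%E ->
    \forall n \near \oo, (b%:E <= log_max_ratio Xs n w)%E}.
Proof.
pose Q (k : nat) w := forall q : rat, choice.unpickle k = Some q -> 0 < q ->
  ((ratr q : R)%:E < (rho2 X)^-1)%E ->
  \forall n \near \oo, ((ratr q : R)%:E <= log_max_ratio Xs n w)%E.
have : {ae P, forall w k, Q k w}.
  apply: ae_foralln => k; rewrite /Q.
  case: (choice.unpickle k) => [q|]; last by apply: aeW.
  have [q0|q0] := ltP 0 q; last by apply: aeW => w _ [<-]; rewrite ltNge q0.
  have [qL|qL] := ltP (ratr q : R)%:E (rho2 X)^-1%E; last first.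
    by apply: aeW => w _ [<-] _; rewrite ltNge qL.
  have q0' : 0 < (ratr q : R) by rewrite ltr0q.
  by apply: filterS (log_max_ratio_ge _ q0' qL) => w Hw _ [<-].
apply: filterS => w Qw b bL.
have [b0|b0] := leP b 0.
  apply: nearW => n; rewrite lee_fin (le_trans b0)// divr_ge0//.
    exact: le_trans (logp_ge1 _).
  exact: le_trans (logp_ge1 _).
(* A real [c] is inserted first because [1/rho2] may be [+oo], while the rational is sought in a
   real interval. *)
have [c bc cL] : exists2 c : R, b < c & (c%:E < (rho2 X)^-1)%E.
  case: (_^-1)%E bL => [L| |]//; last by exists (b + 1); rewrite ?ltrDl ?ltry.
  by rewrite lte_fin => bL; exists ((b + L) / 2); rewrite ?lte_fin; lra.
have [q] := rat_in_itvoo bc; rewrite in_itv/= => /andP[bq qc].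
have q0 : 0 < q by rewrite -(ltr0q R) (lt_trans b0).
have qL : ((ratr q : R)%:E < (rho2 X)^-1)%E.
  by rewrite (lt_trans _ cL)// lte_fin.
apply: filterS (Qw _ _ (choice.pickleK q) q0 qL) => n; apply: le_trans.
by rewrite lee_fin ltW.
Qed.

(** This is the union bound, obtained here from Bernoulli's inequality applied to the exact
    distribution of the maximum. *)
Lemma prob_partial_max_gt (m : nat) (x : R) : (0 < m)%N ->
  (P [set w | (x < partial_max Xs m w)%R] <= (m%:R * G x)%:E)%E.
Proof.
move=> m0.
have -> : [set w | x < partial_max Xs m w] =
    ~` [set w | partial_max Xs m w <= x].
  by apply/seteqP; split => w /=; rewrite ltNge => /negP.
rewrite probability_setC; last exact: measurable_partial_max_le.
rewrite (prob_partial_max_le X)// -EFinB lee_fin lerBlDr addrC -lerBlDr.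
by apply: bernoulli_ge; rewrite fine_ccdf_ge0 fine_ccdf_le1.
Qed.

End iid_maxima.

(** * The norming sequence and convergence along it *)

(* [g] stands for the tail function, [v] for 1/rho2 and [N] for the previous
   term of the sequence. *)
Definition upper_step {R : realType} (g : R -> R) (v : R) (n N m : nat) :=
  (N < m)%N /\ exists x, [/\ expR 1 <= x, m%:R * g x <= (n.+1%:R ^+ 2)^-1 &
    ln x <= (v + n.+1%:R^-1) * ln m%:R].

(* The default value N + 1 of [xget] makes the sequence increasing for every
   [g] and [v], including those that admit no [upper_step]. *)
Fixpoint upper_seq {R : realType} (g : R -> R) (v : R) (n : nat) : nat :=
  let N := if n is n'.+1 then upper_seq g v n' else 0%N in
  xget N.+1 [set m | upper_step g v n N m].

(** Taking a law as argument makes the dependence on the distribution alone explicit. At index 0 the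
    limit is [+oo], the lower estimate suffices, and a fixed sequence works. *)
Definition norming_seq {R : realType} (mu : probability R R) : nat -> nat :=
  let g x := mu `]x, +oo[%classic in
  if tail_index g == 0%E then succn
  else upper_seq (fine \o g) (fine (tail_index g)^-1%E).

Lemma upper_seq_gt {R : realType} (g : R -> R) (v : R) (n : nat) :
  ((if n is n'.+1 then upper_seq g v n' else 0) < upper_seq g v n)%N.
Proof. by case: n => [|n] /=; case: xgetP => // m _ []. Qed.

Lemma norming_seq_gt0 {R : realType} (mu : probability R R) n :
  (0 < norming_seq mu n)%N.
Proof.
rewrite /norming_seq; case: ifP => // _.
exact: leq_ltn_trans (upper_seq_gt _ _ n).
Qed.

Lemma norming_seq_ltS {R : realType} (mu : probability R R) n :
  (norming_seq mu n < norming_seq mu n.+1)%N.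
Proof.
by rewrite /norming_seq; case: ifP => // _; exact: upper_seq_gt _ _ n.+1.
Qed.

Lemma leq_norming_seq {R : realType} (mu : probability R R) n :
  (n <= norming_seq mu n)%N.
Proof.
by elim: n => // n IHn; exact: leq_ltn_trans IHn (norming_seq_ltS mu n).
Qed.

Section norming_sequence.
Context {R : realType} {d0} {T0 : measurableType d0} {P0 : probability T0 R}.
Context (X : {RV P0 >-> R}).

Lemma tail_exponents_near_rho2 (u : R) : 0 < u -> ((u^-1)%:E < rho2 X)%E ->
  exists r, [/\ tail_exponents (ccdf X) r, 0 < r & r^-1 <= u].
Proof.
move=> u0 /ereal_sup_gt[_ [r rX <-]]; rewrite lte_fin => ur.
have r0 : 0 < r by rewrite (lt_trans _ ur)// invr_gt0.
exists r; split => //.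
by rewrite -[leRHS]invrK lef_pV2 ?posrE ?invr_gt0// ltW.
Qed.

(** Covers [0 < rho2 < +oo] and [rho2 = +oo] together: [1/rho2] is a real [v], and [1/(v + e)] falls
    strictly below [rho2], leaving room for a tail exponent. *)
Lemma inv_rho2_fin : rho2 X != 0%E ->
  [/\ (rho2 X)^-1%E = (fine (rho2 X)^-1%E)%:E, 0 <= fine (rho2 X)^-1%E &
  forall e : R, 0 < e -> (((fine (rho2 X)^-1%E + e)^-1)%:E < rho2 X)%E].
Proof.
case: (rho2 X) (rho2_ge0 X) => [t| |]//; last first.
  by rewrite invey /= => _ _; split => // e _; rewrite ltry.
rewrite lee_fin eqe inver => t0 tn0; rewrite (negbTE tn0)/= invr_ge0.
have {tn0} {}t0 : 0 < t by rewrite lt_neqAle eq_sym tn0.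
split => //; first exact: ltW.
move=> e e0; have it0 : 0 < t^-1 by rewrite invr_gt0.
by rewrite lte_fin -[ltRHS]invrK ltf_pV2 ?posrE ?addr_gt0// ltrDl.
Qed.

(** Each stage admits an [upper_step], so [xget] returns one instead of its default: take a tail
    exponent [r] with [1/r <= v + 1/(n+1)]. *)
Lemma upper_step_norming_seq n : rho2 X != 0%E ->
  exists x, [/\ expR 1 <= x,
    (norming_seq (distribution P0 X) n)%:R * fine (ccdf X x)
      <= (n.+1%:R ^+ 2)^-1 &
    ln x <= (fine (rho2 X)^-1%E + n.+1%:R^-1) *
      ln (norming_seq (distribution P0 X) n)%:R].
Proof.
move=> rho0; have [_ v0 ltrho] := inv_rho2_fin rho0.
rewrite /norming_seq -[tail_index _]/(rho2 X) (negbTE rho0).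
set v := fine _ in v0 ltrho *; set m := upper_seq _ _.
suff [N [_]] : exists N, upper_step (fine \o ccdf X) v n N (m n) by [].
pose N := if n is n'.+1 then m n' else 0%N; exists N.
have -> : m n = xget N.+1 [set k | upper_step (fine \o ccdf X) v n N k].
  by rewrite /N /m; case: (n).
apply: xgetPex.
have n0 : 0 < n.+1%:R^-1 :> R by rewrite invr_gt0.
have [r [rX r0 rv]] := tail_exponents_near_rho2 _ (ltr_wpDl v0 n0) (ltrho _ n0).
have e0 : 0 < (n.+1%:R ^+ 2)^-1 :> R by rewrite invr_gt0 exprn_gt0.
have [k [x [Nk ex kx xk]]] := tail_exponents_ccdf_le X r _ N rX r0 e0.
exists k; split => //; exists x; split => //.
apply: (le_trans xk); rewrite ler_wpM2r// ln_ge0// ler1n.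
exact: leq_ltn_trans Nk.
Qed.

Context {d} {T : measurableType d} {P : probability T R}.
Context (Xs : nat -> {RV P >-> R}) (iidX : iid_with_cdf (cdf X) Xs).
Let m := norming_seq (distribution P0 X).

Lemma ae_log_max_ratio_le : rho2 X != 0%E ->
  {ae P, forall w, \forall n \near \oo,
    (log_max_ratio Xs (m n) w
      <= (fine (rho2 X)^-1%E + n.+1%:R^-1)%:E)%E}.
Proof.
move=> rho0.
have [x xP] := choice (fun n => upper_step_norming_seq n rho0).
have mA n : measurable [set w | x n < partial_max Xs (m n) w].
  have -> : [set w | x n < partial_max Xs (m n) w] =
      ~` [set w | partial_max Xs (m n) w <= x n].
    by apply/seteqP; split => w /=; rewrite ltNge => /negP.
  apply: measurableC; apply: measurable_partial_max_le.
  exact: norming_seq_gt0.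
have Plt : \forall n \near \oo, (P [set w | (x n < partial_max Xs (m n) w)%R]
    <= (1 / n.+1%:R ^+ 2)%:E)%E.
  apply: nearW => n; have [_ mx _] := xP n.
  apply: (le_trans (prob_partial_max_gt X Xs iidX _ _ (norming_seq_gt0 _ _))).
  by rewrite lee_fin div1r.
apply: filterS (borel_cantelli_inv_sqr P _ 1 mA Plt) => w.
apply: filterS => n /negP.
rewrite -leNgt => Mx; have [ex _ xm] := xP n.
have [_ v0 _] := inv_rho2_fin rho0.
rewrite lee_fin ler_pdivrMr; last exact: lt_le_trans (logp_ge1 _).
apply: (le_trans (ler_logp _ _ Mx)); rewrite logp_id//.
(* Passing from [ln] to [logp] covers terms [m n] below [e]; it uses that the coefficient is
   nonnegative. *)
apply: (le_trans xm); rewrite ler_wpM2l ?ln_le_logp//.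
by rewrite addr_ge0// invr_ge0.
Qed.

Lemma ae_log_max_ratio_cvg :
  {ae P, forall w, log_max_ratio Xs (m n) w @[n --> \oo] --> ((rho2 X)^-1)%E}.
Proof.
have moo (Q : set nat) : (\forall n \near \oo, Q n) ->
    \forall n \near \oo, Q (m n).
  move=> [N _ NQ]; exists N => // n Nn; apply: NQ => /=.
  exact: leq_trans Nn (leq_norming_seq _ n).
have := ae_log_max_ratio_ge X Xs iidX.
have [rho0|rho0] := eqVneq (rho2 X) 0%E.
  (* With limit [+oo], the lower estimate at every real [A] is already the convergence. *)
  apply: filterS => w geL; rewrite rho0 inve0; apply/cvgeyPge => A.
  have := geL A; rewrite rho0 inve0 ltry => /(_ isT); exact: moo.
apply: filterS2 (ae_log_max_ratio_le rho0) => w leL geL.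
have [vE _ _] := inv_rho2_fin rho0; move: geL leL; rewrite vE /=.
move: (fine _) => v geL leL.
apply: cvg_EFin; first by apply: nearW.
apply/cvgrPdist_le => e e0; near=> n.
have : ((v - e)%:E <= log_max_ratio Xs (m n) w)%E.
  near: n; apply: (moo (fun n => ((v - e)%:E <= log_max_ratio Xs n w)%E)).
  by apply: geL; rewrite lte_fin ltrBlDr ltrDl.
have : (log_max_ratio Xs (m n) w <= (v + n.+1%:R^-1)%:E)%E by near: n.
have : n.+1%:R^-1 <= e.
  by rewrite ltW//; near: n; exact: near_infty_natSinv_lt (PosNum e0).
rewrite /= !lee_fin; move: (_ / _) (n.+1%:R^-1) => z y ? ? ?.
by rewrite ler_distlC; apply/andP; split; lra.
Unshelve. all: by end_near. Qed.

End norming_sequence.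

(** * Comparison of lower limits and conclusion *)

Lemma le_limn_einf {R : realType} (u : (\bar R)^nat) (L : \bar R) :
  (forall b : R, (b%:E < L)%E -> \forall n \near \oo, (b%:E <= u n)%E) ->
  (L <= limn_einf u)%E.
Proof.
move=> geL; apply: lee_EFin_dense => b /geL[N _ Nb].
rewrite limn_einf_lim; apply: lime_ge; first exact: is_cvg_einfs.
exists N => // n /= Nn; apply: le_ereal_inf_tmp => _ [k /= nk <-].
by apply: Nb => /=; exact: leq_trans nk.
Qed.

(** Since [m n >= n], the term [u (m n)] is at least the infimum of [u] from [n] on; then pass to
    the limit. *)
Lemma limn_einf_le_subseq {R : realType} (u : (\bar R)^nat) (m : nat -> nat)
    (L : \bar R) :
  (forall n, (n <= m n)%N) -> u (m n) @[n --> \oo] --> L ->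
  (limn_einf u <= L)%E.
Proof.
move=> mn umL; rewrite limn_einf_lim -(cvg_lim _ umL)//.
apply: lee_lim; [exact: is_cvg_einfs|by apply/cvg_ex; exists L|].
by apply: nearW => n; apply: ereal_inf_lbound; exists (m n) => //=; exact: mn.
Qed.

(* The sequence [m] is a function of the probability distribution of X alone,
   and is the same for all distributions with rho2 = 0. *)
Theorem theorem2p2 (R : realType) :
  (forall (d0 : measure_display) (T0 : measurableType d0)
      (P0 : probability T0 R) (X : {RV P0 >-> R})
      (d : measure_display) (T : measurableType d)
      (P : probability T R) (Xs : nat -> {RV P >-> R}),
    iid_with_cdf (cdf X) Xs ->
    {ae P, forall w,
      limn_einf (fun n => log_max_ratio Xs n w) = ((rho2 X)^-1)%E}) /\
  (exists m : probability R R -> nat -> nat,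
    [/\ forall mu, (forall n, (0 < m mu n)%N) /\
                   (forall n, (m mu n < m mu n.+1)%N),
        forall (d0 : measure_display) (T0 : measurableType d0)
            (P0 : probability T0 R) (X : {RV P0 >-> R})
            (d1 : measure_display) (T1 : measurableType d1)
            (P1 : probability T1 R) (Y : {RV P1 >-> R}),
          rho2 X = 0%E -> rho2 Y = 0%E ->
          m (distribution P0 X) = m (distribution P1 Y)
      & forall (d0 : measure_display) (T0 : measurableType d0)
            (P0 : probability T0 R) (X : {RV P0 >-> R})
            (d : measure_display) (T : measurableType d)
            (P : probability T R) (Xs : nat -> {RV P >-> R}),
          iid_with_cdf (cdf X) Xs ->
          {ae P, forall w,
            log_max_ratio Xs (m (distribution P0 X) n) w @[n --> \oo]
              --> ((rho2 X)^-1)%E}]).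
Proof.
split.
  move=> d0 T0 P0 X d T P Xs iidX.
  have := ae_log_max_ratio_ge X Xs iidX.
  (* The upper half of the liminf identity is inherited from the convergence along [norming_seq]. *)
  apply: filterS2 (ae_log_max_ratio_cvg X Xs iidX) => w cvL geL.
  apply/eqP; rewrite eq_le; apply/andP; split; last exact: le_limn_einf.
  exact: limn_einf_le_subseq (leq_norming_seq _) cvL.
exists norming_seq; split.
- by move=> mu; split => n; [exact: norming_seq_gt0|exact: norming_seq_ltS].
- move=> d0 T0 P0 X d1 T1 P1 Y rhoX rhoY; rewrite /norming_seq.
  rewrite -[tail_index _]/(rho2 X) rhoX eqxx.
  by rewrite -[tail_index _]/(rho2 Y) rhoY eqxx.
- move=> d0 T0 P0 X d T P Xs iidX; exact: ae_log_max_ratio_cvg.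
Qed.
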